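(* Let $F$ be a distribution with a unimodal density on $[0,2]$ and mean $1$. Then $F\in\mathcal D_2^{\mathrm U}$, i.e. there exist random variables $X_1,X_2$, each uniformly distributed on $[0,1]$, such that $X_1+X_2$ has distribution $F$.
   Context: $\mathcal D_2^{\mathrm U}$ is the set of all distributions of $X_1+X_2$, where $X_1,X_2$ are random variables on a common atomless probability space, each uniformly distributed on $[0,1]$, with arbitrary joint distribution. A density function $f$ is unimodal if there exists $x_0\in\mathbb R$ such that $f$ is increasing (in the weak sense) on $(-\infty,x_0]$ and decreasing (in the weak sense) on $[x_0,\infty)$; ''on $[0,2]$'' means that $F$ is supported in $[0,2]$. *)

(* Defs.v *)
From HB Require Import structures.
From mathcomp Require Import all_boot all_order all_algebra.
From mathcomp Require Import all_classical all_reals all_analysis.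
From mathcomp Require Import measurable_realfun.

Set Implicit Arguments.
Unset Strict Implicit.
Unset Printing Implicit Defensive.

Import Order.TTheory GRing.Theory Num.Theory.
Import numFieldNormedType.Exports.

Local Open Scope classical_set_scope.
Local Open Scope ring_scope.

Definition atomless (d : measure_display) (T : measurableType d) (R : realType)
    (P : probability T R) : Prop :=
  forall A : set T, measurable A -> (0 < P A)%E ->
    exists B : set T,
      [/\ measurable B, B `<=` A, (0 < P B)%E & (P B < P A)%E].

(* Laws are compared on measurable sets only: a measure of the library is a
   function on all sets, whose values elsewhere are irrelevant. *)
Definition has_law (d : measure_display) (T : measurableType d) (R : realType)
    (P : probability T R) (X : {RV P >-> R}) (mu : set R -> \bar R) : Prop :=
  forall A : set R, measurable A -> distribution P X A = mu A.

(* The probability space is part of the existential, so that the joint law of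
   X1 and X2 is arbitrary. *)
Definition D2U (R : realType) : set (probability (measurableTypeR R) R) :=
  [set F | exists (d : measure_display) (T : measurableType d)
                  (P : probability T R) (X1 X2 : {RV P >-> R}),
     [/\ atomless P,
         has_law X1 (uniform_prob (@ltr01 R)),
         has_law X2 (uniform_prob (@ltr01 R)) &
         has_law (X1 \+ X2 : {RV P >-> R}) F]].

Definition is_density (R : realType) (F : probability (measurableTypeR R) R)
    (f : R -> R) : Prop :=
  [/\ measurable_fun setT f,
      forall x, 0 <= f x &
      forall A : set R, measurable A ->
        F A = (\int[lebesgue_measure]_(x in A) (f x)%:E)%E].

Definition unimodal (R : realType) (f : R -> R) : Prop :=
  exists x0 : R,
    (forall x y, x <= y -> y <= x0 -> f x <= f y) /\
    (forall x y, x0 <= x -> x <= y -> f y <= f x).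

(* Main.v *)
(** Write [S = 1 + D], so that [D] has mean [0], and let [m] be a mode of [D].
    Slicing the area under the density horizontally, on each side of the mode
    separately, exhibits the law of [D] as a mixture of uniform laws between
    [m] and a random point [t].  Pairing a slice of negative mean ([t < -m])
    with one of nonnegative mean ([t >= -m]), each weighted by the absolute
    moment of the other, turns it into a mixture of centred two-step
    densities, of the form [b^2 - m^2] on [[-a, m]] and [a^2 - m^2] on
    [[m, b]].  Up to the reflection [D -> -D] one may take
    [0 <= m <= min(a, b)], and then such a law is that of [X1 + X2 - 1] for a
    point [(X1, X2)] running uniformly along five weighted segments inscribed
    in the unit square; the two coordinates of this point, pooled together,
    are uniform, so that exchanging them with probability [1/2] makes each of
    them uniform.  If there is no slice of negative mean, then [D] is uniform
    on a symmetric interval and a triangle replaces the five segments. *)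

Require Import Defs.
From HB Require Import structures.
From mathcomp Require Import all_boot all_order all_algebra.
From mathcomp Require Import all_classical all_reals all_analysis.
From mathcomp Require Import measurable_realfun.
From mathcomp Require Import ring lra.

Import Order.TTheory GRing.Theory Num.Theory.
Import numFieldNormedType.Exports.

Local Open Scope classical_set_scope.
Local Open Scope ring_scope.

Set Implicit Arguments.
Unset Strict Implicit.
Unset Printing Implicit Defensive.

(** * Two-step densities from weighted segments *)

(* [I c d] stands for the mass that the uniform law on the segment from [c] to [d]
   gives to a fixed set, and [psi] for a primitive of the indicator of that set.
   Since the orientation of the segment is irrelevant here, equalities between
   mixtures of such laws become ring identities, without any case analysis on
   the relative positions of the end points. *)
Definition chord (R : realFieldType) (I : R -> R -> R) (psi : R -> R) :=
  forall c d, (d - c) * I c d = psi d - psi c.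

Lemma chord_reflect (R : realFieldType) (I : R -> R -> R) psi r :
  chord I psi -> chord (fun c d => I (r - c) (r - d)) (fun x => - psi (r - x)).
Proof. by move=> h c d; have := h (r - c) (r - d); lra. Qed.

Section two_step_polygon.
Context {R : realFieldType}.
Implicit Types a m b : R.

(* The segments join, in this order, A1 to B1, A1 to C1, B1 to C2, A1 to E2 and
   B1 to E2, where A1 = (1 - a, 0), B1 = (1, m), C1 = (1, b), C2 = (b, 1) and
   E2 = (0, 1).  The coordinate sum is 1 - a, 1 + m, 1 + b or 1 at these points.
   The weights solve the linear equations saying that the pooled densities of
   the two coordinates do not jump at 1 - a, m and b, and that the density of
   the sum does not jump at 1. *)
Definition polygon_weight a m b (i : nat) : R :=
  let s := (1 - b) * a ^+ 2 + b * m * (1 - a) in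
  let g := (a - m) * (a + m - a * m) in
  let e := b + m - 2 * b * m in
  match i with
  | 0 => m * s
  | 1 => b * g
  | 2 => (1 - b) * g
  | 3 => (1 - a) * (a * e)
  | _ => m * (1 - a) * e
  end.

Definition polygon_src a m b (i : nat) : R * R :=
  match i with 2 | 4 => (1, m) | _ => (1 - a, 0) end.

Definition polygon_tgt a m b (i : nat) : R * R :=
  match i with 0 => (1, m) | 1 => (1, b) | 2 => (b, 1) | _ => (0, 1) end.

(** The numerator clears the lengths [a + m], [b - m] and [a + b] of the intervals swept by the
    coordinate sum on the first three segments; the denominator brings the two heights to
    [b ^+ 2 - m ^+ 2] and [a ^+ 2 - m ^+ 2]. *)
Definition polygon_scale a m b : R :=
  (a + m) * (b - m) * (a + b) *
  (((a + m - a * m) * (a * (1 - b) + b * (1 - m))) ^-1).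

Lemma polygon_marginals a m b (I : R -> R -> R) psi : chord I psi ->
  \sum_(i < 5) polygon_weight a m b i *
    (I (polygon_src a m b i).1 (polygon_tgt a m b i).1 +
     I (polygon_src a m b i).2 (polygon_tgt a m b i).2) =
  2 * (\sum_(i < 5) polygon_weight a m b i) * (psi 1 - psi 0).
Proof.
move=> ch; rewrite !big_ord_recl !big_ord0 /=.
rewrite /polygon_weight /=.
set s := (1 - b) * _ + _; set g := (a - m) * _; set e := b + m - _.
(* On two segments the first coordinate runs from [1 - a] to [1], and on two the second one runs
   from [m] to [1]. Their joint weights are multiples of the lengths [a] and [1 - m], so that
   [chord] applies without any division. *)
have Eae : m * s + b * g = a * (a * e) by rewrite /s /g /e; ring.
have Ems : (1 - b) * g + m * (1 - a) * e = (1 - m) * s by rewrite /s /g /e; ring.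
transitivity (e * a * ((1 - (1 - a)) * I (1 - a) 1)
  + s * ((m - 0) * I 0 m) + g * ((b - 0) * I 0 b) - g * ((b - 1) * I 1 b)
  + s * ((1 - m) * I m 1) - a * e * ((0 - (1 - a)) * I (1 - a) 0)
  + (1 - a) * (a * e) * ((1 - 0) * I 0 1)
  - m * (1 - a) * e * ((0 - 1) * I 1 0)).
  have -> : e * a * ((1 - (1 - a)) * I (1 - a) 1) = (m * s + b * g) * I (1 - a) 1.
    by rewrite Eae; ring.
  have -> : s * ((1 - m) * I m 1) = ((1 - b) * g + m * (1 - a) * e) * I m 1.
    by rewrite Ems; ring.
  by ring.
rewrite !ch /s /g /e; ring.
Qed.

Lemma polygon_sum a m b (I : R -> R -> R) psi : chord I psi ->
  (a + m - a * m) * (a * (1 - b) + b * (1 - m)) != 0 ->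
  \sum_(i < 5) polygon_scale a m b * polygon_weight a m b i *
    I ((polygon_src a m b i).1 + (polygon_src a m b i).2)
      ((polygon_tgt a m b i).1 + (polygon_tgt a m b i).2) =
  (b ^+ 2 - m ^+ 2) * (psi (1 + m) - psi (1 - a)) +
  (a ^+ 2 - m ^+ 2) * (psi (1 + b) - psi (1 + m)).
Proof.
move=> ch den0; rewrite !big_ord_recl !big_ord0 /=.
rewrite !addr0 add0r (addrC b 1) /polygon_weight /polygon_scale /=.
set D := (a + m - a * m) * _ in den0 *.
set s := (1 - b) * _ + _; set g := (a - m) * _; set e := b + m - _.
apply: (mulfI den0).
(* The weights of the last two segments carry the factors [a] and [m], the lengths of their images
   on either side of [1]; so both have density [(1 - a) * e] there, and together they fill the span
   from [1 - a] to [1 + m]. *)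
transitivity (m * s * (b - m) * (a + b) * ((1 + m - (1 - a)) * I (1 - a) (1 + m))
  + b * g * (a + m) * (b - m) * ((1 + b - (1 - a)) * I (1 - a) (1 + b))
  + (1 - b) * g * (a + m) * (a + b) * ((1 + b - (1 + m)) * I (1 + m) (1 + b))
  + (1 - a) * e * (a + m) * (b - m) * (a + b) *
    ((1 - (1 - a)) * I (1 - a) 1 - (1 - (1 + m)) * I (1 + m) 1)).
  by field.
rewrite !ch /D /s /g /e; ring.
Qed.

Lemma polygon_weight_ge0 a m b i : 0 <= m -> m <= a -> a <= 1 -> m <= b -> b <= 1 ->
  0 <= polygon_weight a m b i.
Proof.
move=> m0 ma a1 mb b1.
have a0 : 0 <= a by lra.
have b0 : 0 <= b by lra.
have amm : 0 <= a * (1 - m) by apply: mulr_ge0; lra.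
have bm : 0 <= b * (1 - m) by apply: mulr_ge0; lra.
have mb' : 0 <= m * (1 - b) by apply: mulr_ge0; lra.
have e0 : 0 <= b + m - 2 * b * m by lra.
have g0 : 0 <= (a - m) * (a + m - a * m) by apply: mulr_ge0; lra.
have s0 : 0 <= (1 - b) * a ^+ 2 + b * m * (1 - a).
  apply: addr_ge0; last by do 2?[apply: mulr_ge0]; lra.
  by apply: mulr_ge0; [lra|exact: exprn_ge0].
have [a1' b1'] : 0 <= 1 - a /\ 0 <= 1 - b by split; lra.
case: i => [|[|[|[|i]]]] /=; do ?[apply: mulr_ge0 => //].
Qed.

Lemma polygon_den_ge0 a m b : 0 <= m -> m <= a -> a <= 1 -> m <= b -> b <= 1 ->
  0 <= (a + m - a * m) * (a * (1 - b) + b * (1 - m)).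
Proof.
move=> m0 ma a1 mb b1; apply: mulr_ge0.
  have : 0 <= a * (1 - m) by apply: mulr_ge0; lra.
  by lra.
by apply: addr_ge0; apply: mulr_ge0; lra.
Qed.

End two_step_polygon.

(** * Segments and Lebesgue measure *)

Notation pushforward_measure :=
  measure_function_pushforward__canonical__measure_function_Measure.

Section lebesgue_chord.
Context {R : realType}.
Local Notation leb := (@lebesgue_measure R).
Implicit Types (A : set R) (c d k x : R).

Lemma measurable_affine c k :
  measurable_fun [set: measurableTypeR R]
    (fun u : measurableTypeR R => (c + u * k : measurableTypeR R)).
Proof. by apply: measurable_funD => //; apply: measurable_funM. Qed.

(** By uniqueness of Lebesgue measure only half-open intervals need checking; for [k < 0] the
    preimage is closed at the other end, which leaves its length unchanged. *)
Lemma lebesgue_measure_affine c k A : measurable A -> k != 0 ->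
  leb A = (`|k|%:E * leb [set u | A (c + u * k)%R])%E.
Proof.
move=> mA k0.
have m_ := measurable_affine c k.
pose pfM : {measure set (measurableTypeR R) -> \bar R} := pushforward_measure leb m_.
rewrite (@lebesgue_measure_unique R (mscale `|k|%:nng pfM))//.
move=> _ [[x y] _ <-] /=; rewrite /mscale/= /pushforward.
have [k_lt0|k_gt0] : k < 0 \/ 0 < k by apply/orP; rewrite -neq_lt.
- rewrite (_ : _ @^-1` _ = `[(y - c) / k, (x - c) / k[%classic); last first.
    apply/seteqP; split => u /=; rewrite !in_itv/= ler_ndivrMr// ltr_ndivlMr//; lra.
  rewrite !lebesgue_measure_itv/= !lte_fin ltr_nM2r ?invr_lt0// ltrD2r.
  case: ifPn => xy; last by rewrite mule0.
  rewrite -!EFinD -EFinM; congr (_%:E).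
  by rewrite ltr0_norm//; field.
- rewrite (_ : _ @^-1` _ = `](x - c) / k, (y - c) / k]%classic); last first.
    apply/seteqP; split => u /=; rewrite !in_itv/= ler_pdivlMr// ltr_pdivrMr//; lra.
  rewrite !lebesgue_measure_itv/= !lte_fin ltr_pM2r ?invr_gt0// ltrD2r.
  case: ifPn => xy; last by rewrite mule0.
  rewrite -!EFinD -EFinM; congr (_%:E).
  by rewrite gtr0_norm//; field.
Qed.

Definition itv_len A c d : R := fine (leb (A `&` `[c, d])).

Lemma lebesgue_itv_fin A c d : measurable A ->
  leb (A `&` `[c, d]) \is a fin_num.
Proof.
move=> mA; rewrite ge0_fin_numE ?measure_ge0//.
apply: (@le_lt_trans _ _ (leb `[c, d]%classic)).
  by apply: le_measure; rewrite ?inE//; exact: measurableI.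
by rewrite lebesgue_measure_itv/=; case: ifP; rewrite -?EFinD ltry.
Qed.

Lemma itv_len_ge A c d : measurable A -> d <= c -> itv_len A c d = 0.
Proof.
move=> mA dc; rewrite /itv_len.
rewrite (@subset_measure0 _ _ _ leb (A `&` `[c, d]) [set c])//.
- exact: measurableI.
- by move=> x /= [_]; rewrite in_itv/= => xcd; apply/eqP; rewrite eq_le; lra.
- exact: lebesgue_measure_set1.
Qed.

Lemma itv_len_cat A c x d : measurable A -> c <= x -> x <= d ->
  itv_len A c d = itv_len A c x + itv_len A x d.
Proof.
move=> mA cx xd; rewrite /itv_len -fineD ?lebesgue_itv_fin//; congr fine.
rewrite (@itv_bndbnd_setU _ _ (BLeft c) (BLeft x) (BRight d)) ?bnd_simp//.
rewrite setIUr measureU//; [|exact: measurableI..|].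
  congr (_ + _)%E.
  rewrite -(@setUitv1 _ _ (BLeft c) x true) ?bnd_simp// setIUr measureU0//;
    [exact: measurableI..|].
  by apply: (@subset_measure0 _ _ _ leb (A `&` [set x]) [set x]) => //;
    [exact: measurableI|exact: lebesgue_measure_set1].
apply/seteqP; split => // y /= [[_]]; rewrite in_itv/= => ? [_].
by rewrite in_itv/=; lra.
Qed.

(** A primitive of the indicator of [A] that vanishes at [0]: at most one of the terms is nonzero,
    since [itv_len] is [0] on reversed intervals. *)
Definition signed_len A x : R := itv_len A 0 x - itv_len A x 0.

Lemma signed_lenB A c d : measurable A -> c <= d ->
  signed_len A d - signed_len A c = itv_len A c d.
Proof.
move=> mA cd; rewrite /signed_len.
have [c0|/ltW c0] := leP 0 c.
  rewrite (@itv_len_cat A 0 c d)// (@itv_len_ge _ d 0) ?(le_trans c0)//.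
  by rewrite (@itv_len_ge _ c 0)//; ring.
have [d0|/ltW d0] := leP 0 d.
  rewrite (@itv_len_cat A c 0 d)// (@itv_len_ge _ d 0)// (@itv_len_ge _ 0 c)//.
  by ring.
rewrite (@itv_len_cat A c d 0)// (@itv_len_ge _ 0 d)// (@itv_len_ge _ 0 c)//.
by ring.
Qed.

(** With the parameter in [[0, 1]], the case [c = d] is a point mass and needs no separate
    definition. *)
Definition segment_len A c d : R :=
  fine (leb (`[0, 1] `&` [set u | A (c + u * (d - c))])).

Lemma chord_segment_len A : measurable A -> chord (segment_len A) (signed_len A).
Proof.
move=> mA c d; have [->|cd] := eqVneq c d; first by rewrite !subrr mul0r.
have k0 : d - c != 0 by rewrite subr_eq0 eq_sym.
pose S : set R := [set u | A (c + u * (d - c))].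
have mS : measurable S by rewrite -[X in measurable X]setTI; exact: measurable_affine.
(* Both orientations use this change of variables; [B] is the closed interval that the segment
   fills. *)
have key B : measurable B -> [set u | B (c + u * (d - c))] = `[0, 1]%classic ->
    `|d - c| * segment_len A c d = fine (leb (A `&` B)).
  move=> mB BE; rewrite (@lebesgue_measure_affine c (d - c))//; last exact: measurableI.
  rewrite (_ : [set u | _] = S `&` `[0, 1]); last by rewrite -BE.
  by rewrite fineM ?lebesgue_itv_fin//= setIC.
have [dc|{}cd] : d < c \/ c < d by apply/orP; rewrite -neq_lt eq_sym.
- have -> : d - c = - `|d - c| by rewrite ltr0_norm ?opprK// subr_lt0.
  rewrite mulNr (key `[d, c]%classic)//.
    by rewrite -opprB (@signed_lenB A d c)// ltW.
  apply/seteqP; split => u /=; rewrite !in_itv/= => /andP[? ?]; apply/andP; split; nra.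
- have -> : d - c = `|d - c| by rewrite gtr0_norm// subr_gt0.
  rewrite (key `[c, d]%classic)//; first by rewrite (@signed_lenB A c d)// ltW.
  apply/seteqP; split => u /=; rewrite !in_itv/= => /andP[? ?]; apply/andP; split; nra.
Qed.

End lebesgue_chord.

(** * Mixtures of measures on the plane *)

Section mixture.
Context {R : realType} d (Om : measurableType d).
Local Notation leb := (@lebesgue_measure R).
Local Notation plane := (measurableTypeR R * measurableTypeR R)%type.

Lemma uniform_probE (A : set R) : measurable A ->
  uniform_prob (@ltr01 R) A = leb (A `&` `[0, 1]).
Proof.
move=> mA; rewrite /uniform_prob integral_uniform_pdf.
rewrite (eq_integral (cst 1%E)); last first.
  move=> x; rewrite inE => -[_ /=]; rewrite in_itv/= /uniform_pdf => ->.
  by rewrite subr0 invr1.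
by rewrite integral_cst ?mul1e//; exact: measurableI.
Qed.

(** Cut [A] along the values of [X] into pieces over intervals of length [1/n < P A]. Each piece is
    less likely than [A], and they cannot all be null, because they cover [A] up to the null event
    that [X] leaves [[0, 1]]. *)
Lemma atomless_uniform d' (T : measurableType d') (P : probability T R)
    (X : {RV P >-> R}) :
  has_law X (uniform_prob (@ltr01 R)) -> atomless P.
Proof.
move=> hX A mA PA0.
have [n n0 nA] : exists2 n : nat, (0 < n)%N & (n%:R^-1%:E < P A)%E.
  have PAfin : P A \is a fin_num by exact: fin_num_measure.
  have : 0 < fine (P A) by rewrite fine_gt0// PA0 ltey_eq PAfin.
  move=> p0; exists (Num.truncn (fine (P A))^-1).+1 => //.
  rewrite -(fineK PAfin) lte_fin -[ltRHS]invrK ltf_pV2 ?posrE ?invr_gt0//.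
  exact: truncnS_gt.
pose B (k : nat) := A `&` X @^-1` `[k%:R / n%:R, k.+1%:R / n%:R].
have mB k : measurable (B k) by apply: measurableI => //; exact: measurable_funPTI.
have nR0 : (0 : R) < n%:R by rewrite ltr0n.
have Blt k : (P (B k) < P A)%E.
  apply: le_lt_trans nA.
  apply: (@le_trans _ _ (P (X @^-1` `[k%:R / n%:R, k.+1%:R / n%:R]))).
    by apply: le_measure; rewrite ?inE//;
      do ?[exact: subIsetl|exact: subIsetr|exact: measurableI
        |exact: measurable_funPTI|exact: measurable_funPTI (measurableC _)].
  have := hX `[k%:R / n%:R, k.+1%:R / n%:R]%classic.
  rewrite /distribution /pushforward => -> //.
  rewrite uniform_probE//.
  apply: (@le_trans _ _ (leb `[k%:R / n%:R, k.+1%:R / n%:R]%classic)).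
    by apply: le_measure; rewrite ?inE//;
      do ?[exact: subIsetl|exact: subIsetr|exact: measurableI
        |exact: measurable_funPTI|exact: measurable_funPTI (measurableC _)].
  rewrite lebesgue_measure_itv/= lte_fin ltr_pM2r ?invr_gt0// ltr_nat ltnSn.
  by rewrite -EFinD lee_fin -mulrBl -natr1 addrAC subrr add0r mul1r.
have [[k Bk]|/forallNP noB] := pselect (exists k, (0 < P (B k))%E).
  by exists (B k); split => //; exact: subIsetl.
have B0 k : P (B k) = 0%E.
  by apply/eqP; rewrite eq_le measure_ge0 andbT leNgt; apply/negP; exact: noB.
exfalso; move: PA0; rewrite lt_neqAle measure_ge0 andbT => /eqP; apply.
apply/esym/eqP; rewrite eq_le measure_ge0 andbT.
pose C := A `&` X @^-1` (~` `[0, 1]).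
have mC : measurable C.
  by apply: measurableI => //; apply: measurable_funPTI; exact: measurableC.
have C0 : P C = 0%E.
  apply/eqP; rewrite eq_le measure_ge0 andbT.
  apply: (@le_trans _ _ (P (X @^-1` (~` `[0, 1])))).
    by apply: le_measure; rewrite ?inE//;
      do ?[exact: subIsetl|exact: subIsetr|exact: measurableI
        |exact: measurable_funPTI|exact: measurable_funPTI (measurableC _)].
  have := hX (~` `[0, 1]%classic) (measurableC (measurable_itv _)).
  rewrite /distribution /pushforward => ->.
  by rewrite uniform_probE ?setICl ?measure0//; exact: measurableC.
have : A `<=` C `|` \bigcup_k B k.
  move=> w Aw; have [X01|nX01] := pselect (`[0, 1]%classic (X w)); last by left.
  right; move: X01; rewrite /= in_itv/= => /andP[X0 X1].
  have Xn0 : 0 <= X w * n%:R by rewrite mulr_ge0.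
  exists (Num.truncn (X w * n%:R)) => //; split => //=; rewrite in_itv/=.
  rewrite ler_pdivrMr// ler_pdivlMr//.
  by have /andP[-> /ltW ->] := truncn_itv Xn0.
move=> AU; rewrite (@measure_negligible _ _ _ P A)//.
apply: (negligibleS AU); apply: negligibleU; first exact/(negligibleP _ mC).
by apply: negligible_bigcup => k; apply/(negligibleP _ (mB k)); exact: B0.
Qed.

Variables (mu : {measure set Om -> \bar R}) (kap : Om -> {measure set plane -> \bar R}).
Hypothesis mkap : forall A, measurable A -> measurable_fun setT (kap ^~ A).

Definition mixture (A : set plane) : \bar R := (\int[mu]_w kap w A)%E.

Let mixture0 : mixture set0 = 0%E.
Proof.
rewrite /mixture (eq_integral (cst 0%E)) ?integral0// => w _.
by rewrite measure0.
Qed.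

Let mixture_ge0 A : (0 <= mixture A)%E.
Proof. exact: integral_ge0. Qed.

Let mixture_sigma_additive : semi_sigma_additive mixture.
Proof.
move=> U mU tU mUU; rewrite [X in _ --> X](_ : _ =
  (\int[mu]_w (\sum_(n <oo) kap w (U n)))%E); last first.
  apply: eq_integral => w _.
  by apply/esym/cvg_lim => //; exact/measure_semi_sigma_additive.
apply/cvg_closeP; split.
  by apply: is_cvg_nneseries => n _ _; exact: integral_ge0.
by rewrite closeE// integral_nneseries// => n; exact: mkap.
Qed.

HB.instance Definition _ := isMeasure.Build _ _ R mixture
  mixture0 mixture_ge0 mixture_sigma_additive.

Hypothesis kap_marginals : forall w (A : set R), measurable A ->
  (kap w (fst @^-1` A) + kap w (snd @^-1` A) =
   2%:E * kap w setT * leb (A `&` `[0%R, 1%R]))%E.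

Let swap (p : plane) : plane := (p.2, p.1).

Let measurable_swap : measurable_fun [set: plane] swap.
Proof.
apply/measurable_fun_pairP; split => /=; last exact: measurable_fst.
exact: measurable_snd.
Qed.

Variable F : probability (measurableTypeR R) R.
Hypothesis kap_sum : forall A : set R, measurable A ->
  (\int[mu]_w kap w [set p | A (p.1 + p.2)%R] = F A)%E.

(* The symmetrisation under exchange of coordinates turns the condition on the
   sum of the two marginals into a condition on each of them. *)
Let P : {measure set plane -> \bar R} :=
  mscale (2^-1)%:nng
    (measure_add mixture (pushforward_measure mixture measurable_swap)).

Let PE A : P A = ((2^-1)%:E * (mixture A + mixture (swap @^-1` A)))%E.
Proof. by rewrite /P /mscale; congr (_ * _)%E; exact: measure_addE. Qed.

Let mixtureT : mixture setT = 1%E.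
Proof. by rewrite -(@probability_setT _ _ _ F) -kap_sum. Qed.

Let PT : P setT = 1%E.
Proof.
by rewrite PE preimage_setT mixtureT -EFinD -EFinM; congr EFin; field.
Qed.

Lemma D2U_of_mixture : D2U F.
Proof.
pose pP := Measure_isProbability.Build _ _ _ P PT.
pose Q : probability plane R := HB.pack (Measure.sort P) pP.
pose X1 : {RV Q >-> R} := HB.pack (fst : plane -> R)
  (isMeasurableFun.Build _ _ _ _ (fst : plane -> R) measurable_fst).
pose X2 : {RV Q >-> R} := HB.pack (snd : plane -> R)
  (isMeasurableFun.Build _ _ _ _ (snd : plane -> R) measurable_snd).
have marg (A : set R) : measurable A ->
    (mixture (fst @^-1` A) + mixture (snd @^-1` A) = 2%:E * leb (A `&` `[0%R, 1%R]))%E.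
  move=> mA.
  have m1 : measurable (fst @^-1` A : set plane).
    by rewrite -[X in measurable X]setTI; exact: measurable_fst.
  have m2 : measurable (snd @^-1` A : set plane).
    by rewrite -[X in measurable X]setTI; exact: measurable_snd.
  rewrite /mixture -ge0_integralD//; [|exact: mkap..].
  (* The length of the part of [A] in [[0, 1]] leaves the integral; what remains is the total mass
     of the mixture, which is [1]. *)
  under eq_integral do rewrite kap_marginals// -muleA muleCA.
  rewrite ge0_integralZr//; last 2 first.
  - exact: mkap.
  - by rewrite mule_ge0.
  by rewrite -/(mixture _) mixtureT mul1e.
have law1 : has_law X1 (uniform_prob (@ltr01 R)).
  move=> A mA; rewrite uniform_probE// /distribution /pushforward/= PE.
  rewrite [X in (_ + X)%E](_ : _ = mixture (snd @^-1` A))// marg//.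
  by rewrite muleA -EFinM mulVf// mul1e.
have law2 : has_law X2 (uniform_prob (@ltr01 R)).
  move=> A mA; rewrite uniform_probE// /distribution /pushforward/= PE addeC.
  rewrite [X in (X + _)%E](_ : _ = mixture (fst @^-1` A))// marg//.
  by rewrite muleA -EFinM mulVf// mul1e.
exists _, plane, Q, X1, X2; split => //; first exact: atomless_uniform law1.
move=> A mA; rewrite /distribution /pushforward/= PE.
rewrite [X in (_ + X)%E](_ : _ = mixture [set p | A (p.1 + p.2)]); last first.
  by congr mixture; apply/seteqP; split => -[x y] /=; rewrite addrC.
rewrite [X in (X + _)%E](_ : _ = mixture [set p | A (p.1 + p.2)])//.
rewrite /mixture kap_sum// -(fineK (fin_num_measure F A mA)) -EFinD -EFinM.
by congr EFin; field.
Qed.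

End mixture.

(** * Mixtures of uniform laws on segments *)

Section segments.
Context {R : realType}.
Local Notation leb := (@lebesgue_measure R).
Local Notation plane := (measurableTypeR R * measurableTypeR R)%type.
Implicit Types (p q : R * R) (A : set R).

Definition segment_path p q (u : measurableTypeR R) : plane :=
  (p.1 + u * (q.1 - p.1), p.2 + u * (q.2 - p.2)).

Lemma measurable_segment_path p q :
  measurable_fun [set: measurableTypeR R] (segment_path p q).
Proof. by apply/measurable_fun_pairP; split => /=; exact: measurable_affine. Qed.

Let m01 : measurable (`[0, 1]%classic : set (measurableTypeR R)).
Proof. exact: measurable_itv. Qed.

Definition segment_measure p q : {measure set plane -> \bar R} :=
  pushforward_measure (mrestr leb m01) (measurable_segment_path p q).

Lemma segment_measureE p q (B : set plane) :
  segment_measure p q B = leb (`[0, 1] `&` [set u | B (segment_path p q u)]).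
Proof. by rewrite /segment_measure/= /pushforward /mrestr setIC. Qed.

Lemma segment_lenE A c d : measurable A ->
  (segment_len A c d)%:E = leb (`[0, 1] `&` [set u | A (c + u * (d - c))]).
Proof.
move=> mA; rewrite /segment_len fineK// setIC; apply: lebesgue_itv_fin.
by rewrite -[X in measurable X]setTI; exact: measurable_affine.
Qed.

Lemma segment_measure_fst p q A : measurable A ->
  segment_measure p q (fst @^-1` A) = (segment_len A p.1 q.1)%:E.
Proof. by move=> mA; rewrite segment_measureE segment_lenE. Qed.

Lemma segment_measure_snd p q A : measurable A ->
  segment_measure p q (snd @^-1` A) = (segment_len A p.2 q.2)%:E.
Proof. by move=> mA; rewrite segment_measureE segment_lenE. Qed.

Lemma segment_measure_sum p q A : measurable A ->
  segment_measure p q [set x | A (x.1 + x.2)] =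
  (segment_len A (p.1 + p.2) (q.1 + q.2))%:E.
Proof.
move=> mA; rewrite segment_measureE segment_lenE//; congr (leb (_ `&` _)).
by apply/funext => u /=; congr A; ring.
Qed.

Lemma segment_measureT p q : segment_measure p q setT = 1%E.
Proof.
rewrite segment_measureE [X in _ `&` X](_ : _ = setT)// setIT.
by rewrite lebesgue_measure_itv/= lte_fin ltr01 oppr0 adde0.
Qed.

Context d (Om : measurableType d) (mu : {measure set Om -> \bar R}).
Variables (n : nat) (w : nat -> Om -> R) (p q : nat -> Om -> plane).
Hypotheses (mw : forall i, measurable_fun setT (w i))
  (mp : forall i, measurable_fun setT (p i))
  (mq : forall i, measurable_fun setT (q i))
  (w0 : forall i x, 0 <= w i x).

(** The absolute value only supplies a scalar of nonnegative type; by [w0] it disappears in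
    [kapE]. *)
Let kap (x : Om) : {measure set plane -> \bar R} :=
  msum (fun i => mscale `|w i x|%:nng (segment_measure (p i x) (q i x))) n.

Let kapE x B :
  kap x B = (\sum_(i < n) (w i x)%:E * segment_measure (p i x) (q i x) B)%E.
Proof.
rewrite /kap/= /msum; apply: eq_bigr => i _.
by rewrite /= /mscale/= ger0_norm.
Qed.

Let measurable_segment_measure i (B : set plane) : measurable B ->
  measurable_fun setT (fun x => segment_measure (p i x) (q i x) B).
Proof.
move=> mB.
(* The mass of [B] is the length of the section at [x] of a measurable set in the product of [Om]
   with the parameter line, hence measurable in [x]. *)
pose path (z : Om * measurableTypeR R) : plane := segment_path (p i z.1) (q i z.1) z.2.
have mpath : measurable_fun setT path.
  have mfst (g : Om -> R) : measurable_fun setT g ->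
      measurable_fun setT (fun z : Om * measurableTypeR R => g z.1).
    by move=> mg; apply: (measurableT_comp mg); exact: measurable_fst.
  have msnd : measurable_fun setT (snd : Om * measurableTypeR R -> R).
    exact: measurable_snd.
  have [mp1 mp2] := (measurable_fun_pairP _).1 (mp i).
  have [mq1 mq2] := (measurable_fun_pairP _).1 (mq i).
  apply/measurable_fun_pairP; split => /=.
  - apply: (measurable_funD (mfst _ mp1)); apply: measurable_funM => //.
    exact: measurable_funB (mfst _ mq1) (mfst _ mp1).
  - apply: (measurable_funD (mfst _ mp2)); apply: measurable_funM => //.
    exact: measurable_funB (mfst _ mq2) (mfst _ mp2).
pose S : set (Om * measurableTypeR R) := (setT `*` `[0, 1]%classic) `&` path @^-1` B.
have mS : measurable S.
  apply: measurableI; first exact: measurableX.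
  by rewrite -[X in measurable X]setTI; exact: mpath.
apply: (eq_measurable_fun (leb \o xsection S)); last exact: measurable_fun_xsection.
move=> x _ /=; rewrite segment_measureE; congr (leb _).
apply/seteqP; split => u /=; rewrite /xsection/= inE /S/= => -[].
  by move=> [_ u01] Bu; split.
by move=> u01 Bu; split.
Qed.

Hypothesis chord_marginals : forall x (I : R -> R -> R) psi, chord I psi ->
  \sum_(i < n) w i x * (I (p i x).1 (q i x).1 + I (p i x).2 (q i x).2) =
  2 * (\sum_(i < n) w i x) * (psi 1 - psi 0).

Variable F : probability (measurableTypeR R) R.
Hypothesis segments_sum : forall A, measurable A ->
  (\int[mu]_x (\sum_(i < n) w i x *
    segment_len A ((p i x).1 + (p i x).2) ((q i x).1 + (q i x).2))%R%:E = F A)%E.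

Lemma D2U_of_segments : D2U F.
Proof.
apply: (@D2U_of_mixture _ _ Om mu kap) => [B mB|x A mA|A mA].
- rewrite (_ : kap ^~ B = fun x =>
    (\sum_(i < n) (w i x)%:E * segment_measure (p i x) (q i x) B)%E); last first.
    by apply/funext => x; exact: kapE.
  apply: emeasurable_sum => i; apply: emeasurable_funM.
    exact/measurable_EFinP.
  exact: measurable_segment_measure.
- rewrite !kapE.
  under eq_bigr do rewrite segment_measure_fst// -EFinM.
  under [X in (_ + X)%E]eq_bigr do rewrite segment_measure_snd// -EFinM.
  under [X in (_ * X * _)%E]eq_bigr do rewrite segment_measureT mule1.
  rewrite !sumEFin -(fineK (lebesgue_itv_fin 0 1 mA)) -!EFinM -EFinD; congr EFin.
  rewrite -[fine _]/(itv_len A 0 1) -signed_lenB//.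
  rewrite -(chord_marginals x (chord_segment_len mA)) -big_split/=.
  by apply: eq_bigr => i _; rewrite mulrDr.
- rewrite -segments_sum//; apply: eq_integral => x _.
  rewrite kapE -sumEFin; apply: eq_bigr => i _.
  by rewrite segment_measure_sum// EFinM.
Qed.

End segments.

(** * Two-step densities indexed by three points *)

Section two_step_family.
Context {R : realType}.
Implicit Types (lo mid hi m t : R).

(** A negative middle point is handled by the central symmetry of the unit square, which turns the
    coordinate sum [s] into [2 - s] and so swaps the two arms. *)
Let reflect_if (side : bool) (p : R * R) : R * R :=
  if side then p else (1 - p.1, 1 - p.2).

Let left_arm lo mid hi := if 0 <= mid then - lo else hi.
Let right_arm lo mid hi := if 0 <= mid then hi else - lo.

Definition two_step_weight lo mid hi i :=
  let a := left_arm lo mid hi in let b := right_arm lo mid hi in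
  polygon_scale a `|mid| b * polygon_weight a `|mid| b i.

Definition two_step_src lo mid hi i := reflect_if (0 <= mid)
  (polygon_src (left_arm lo mid hi) `|mid| (right_arm lo mid hi) i).

Definition two_step_tgt lo mid hi i := reflect_if (0 <= mid)
  (polygon_tgt (left_arm lo mid hi) `|mid| (right_arm lo mid hi) i).

Lemma two_step_marginals c lo mid hi (I : R -> R -> R) psi : chord I psi ->
  let w := fun i => c * two_step_weight lo mid hi i in
  let p := two_step_src lo mid hi in let q := two_step_tgt lo mid hi in
  \sum_(i < 5) w i * (I (p i).1 (q i).1 + I (p i).2 (q i).2) =
  2 * (\sum_(i < 5) w i) * (psi 1 - psi 0).
Proof.
move=> ch w p q; rewrite /w /p /q /two_step_weight.
set s := polygon_scale _ _ _.
under eq_bigr do rewrite mulrA -mulrA.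
under [in RHS]eq_bigr do rewrite mulrA.
rewrite -!mulr_sumr [RHS](_ : _ = c * s * (2 * (\sum_(i < 5) polygon_weight
  (left_arm lo mid hi) `|mid| (right_arm lo mid hi) i) * (psi 1 - psi 0))).
  congr (_ * _).
  rewrite /two_step_src /two_step_tgt /reflect_if /left_arm /right_arm.
  case: ifPn => _; first exact: polygon_marginals.
  rewrite (polygon_marginals _ _ _ (chord_reflect 1 ch)).
  by rewrite subrr subr0; ring.
by ring.
Qed.

Lemma two_step_sum lo mid hi (I : R -> R -> R) psi : chord I psi ->
  -1 <= lo -> `|mid| <= - lo -> `|mid| <= hi -> hi <= 1 ->
  let p := two_step_src lo mid hi in let q := two_step_tgt lo mid hi in
  \sum_(i < 5) two_step_weight lo mid hi i *
    I ((p i).1 + (p i).2) ((q i).1 + (q i).2) =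
  (hi ^+ 2 - mid ^+ 2) * (psi (1 + mid) - psi (1 + lo)) +
  (lo ^+ 2 - mid ^+ 2) * (psi (1 + hi) - psi (1 + mid)).
Proof.
move=> ch lo1 midlo midhi hi1 p q; rewrite /p /q /two_step_weight.
(* When the denominator of the scale vanishes, the scale is [0], because [0^-1]
   is [0], and the right-hand side is [0] as well. *)
have sum0 a m b (J : R -> R -> R) phi : chord J phi ->
    0 <= m -> m <= a -> a <= 1 -> m <= b -> b <= 1 ->
    \sum_(i < 5) polygon_scale a m b * polygon_weight a m b i *
      J ((polygon_src a m b i).1 + (polygon_src a m b i).2)
        ((polygon_tgt a m b i).1 + (polygon_tgt a m b i).2) =
    (b ^+ 2 - m ^+ 2) * (phi (1 + m) - phi (1 - a)) +
    (a ^+ 2 - m ^+ 2) * (phi (1 + b) - phi (1 + m)).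
  move=> chJ m0 ma a1 mb b1.
  have [den0|den0] := eqVneq ((a + m - a * m) * (a * (1 - b) + b * (1 - m))) 0;
    last exact: polygon_sum.
  rewrite big1 => [|i _]; last by rewrite /polygon_scale den0 invr0 mulr0 !mul0r.
  have am0 : 0 <= a * (1 - m) by apply: mulr_ge0; lra.
  have ab0 : 0 <= a * (1 - b) by apply: mulr_ge0; lra.
  have bm0 : 0 <= b * (1 - m) by apply: mulr_ge0; lra.
  have [aE|] : (a = 0 /\ m = 0) \/ (a = m /\ b = m).
    move/eqP : den0; rewrite mulf_eq0 => /orP[/eqP h|/eqP h].
      left; have m0' : m = 0 by lra.
      by split => //; rewrite m0' in h; lra.
    have /eqP : a * (1 - b) = 0 by lra.
    have /eqP : b * (1 - m) = 0 by lra.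
    rewrite !mulf_eq0 => /orP[/eqP ?|/eqP ?] /orP[/eqP ?|/eqP ?]; first by left; lra.
    - by left; lra.
    - by right; lra.
    - by right; lra.
  - by case: aE => -> ->; rewrite addr0 subr0; ring.
  - by case=> -> ->; ring.
rewrite /two_step_src /two_step_tgt /reflect_if /left_arm /right_arm.
case: ifPn => [mid0|]; last rewrite -ltNge => mid0.
- rewrite ger0_norm// in midlo midhi *.
  by rewrite (sum0 _ _ _ _ _ ch)//; [rewrite opprK sqrrN|lra].
- rewrite ltr0_norm// in midlo midhi *.
  transitivity (\sum_(i < 5) polygon_scale hi (- mid) (- lo) *
      polygon_weight hi (- mid) (- lo) i *
      (fun c d => I (2 - c) (2 - d))
      ((polygon_src hi (- mid) (- lo) i).1 + (polygon_src hi (- mid) (- lo) i).2)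
      ((polygon_tgt hi (- mid) (- lo) i).1 + (polygon_tgt hi (- mid) (- lo) i).2)).
    by apply: eq_bigr => i _ /=; congr (_ * I _ _); ring.
  rewrite (sum0 _ _ _ _ _ (chord_reflect 2 ch)) => //; [|lra..].
  rewrite !sqrrN.
  have -> : 2 - (1 + - mid) = 1 + mid by ring.
  have -> : 2 - (1 - hi) = 1 + hi by ring.
  have -> : 2 - (1 + - lo) = 1 + lo by ring.
  by ring.
Qed.

Lemma two_step_weight_ge0 lo mid hi i :
  -1 <= lo -> `|mid| <= - lo -> `|mid| <= hi -> hi <= 1 ->
  0 <= two_step_weight lo mid hi i.
Proof.
move=> lo1 midlo midhi hi1; rewrite /two_step_weight /polygon_scale.
have mid0 := normr_ge0 mid.
set a := left_arm _ _ _; set b := right_arm _ _ _.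
have [ma [a1 [mb b1]]] : `|mid| <= a /\ a <= 1 /\ `|mid| <= b /\ b <= 1.
  by rewrite /a /b /left_arm /right_arm; case: ifP => _; repeat split; lra.
rewrite mulr_ge0 ?polygon_weight_ge0// mulr_ge0 ?invr_ge0 ?polygon_den_ge0//.
by rewrite mulr_ge0 ?mulr_ge0//; lra.
Qed.

Section measurability.
Context d (Om : measurableType d) (lo mid hi : Om -> R).
Hypotheses (mlo : measurable_fun setT lo) (mmid : measurable_fun setT mid)
  (mhi : measurable_fun setT hi).

(** The inverse is taken of the square, which is nonnegative, by the measurable power function; at a
    zero of [f] the factor [f x] gives [0], in agreement with [0^-1 = 0]. *)
Lemma measurable_funV (f : Om -> R) : measurable_fun setT f ->
  measurable_fun setT (fun x => (f x)^-1).
Proof.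
move=> mf; rewrite (_ : (fun _ => _) = fun x => f x * (f x ^+ 2) `^ (-1)).
  apply: measurable_funM => //.
  exact: (measurableT_comp (measurable_powR (-1)) (measurable_funX 2 mf)).
apply/funext => x; rewrite powR_inv1 ?sqr_ge0//.
by have [->|fx0] := eqVneq (f x) 0; [rewrite invr0 mul0r|field].
Qed.

Let a x := left_arm (lo x) (mid x) (hi x).
Let b x := right_arm (lo x) (mid x) (hi x).
Let m x : R := `|mid x|.

Let mside : measurable_fun setT (fun x => 0 <= mid x).
Proof. exact: measurable_fun_ler. Qed.

Let ma : measurable_fun setT a.
Proof. by apply: measurable_fun_ifT => //; exact: measurable_funN. Qed.

Let mb : measurable_fun setT b.
Proof. by apply: measurable_fun_ifT => //; exact: measurable_funN. Qed.

Let mm : measurable_fun setT m.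
Proof. exact: measurableT_comp. Qed.

Ltac measurable_poly := repeat first
  [ exact: ma | exact: mb | exact: mm | exact: measurable_cst
  | apply: measurable_funV | apply: measurable_funD | apply: measurable_funN
  | apply: measurable_funM | apply: measurable_funX ].

Lemma measurable_two_step_weight i :
  measurable_fun setT (fun x => two_step_weight (lo x) (mid x) (hi x) i).
Proof.
apply: measurable_funM; first by rewrite /polygon_scale; measurable_poly.
rewrite /polygon_weight.
by case: i => [|[|[|[|i]]]] /=; measurable_poly.
Qed.

Let measurable_reflect (p : Om -> R * R) :
  measurable_fun setT (fst \o p) -> measurable_fun setT (snd \o p) ->
  measurable_fun setT (fun x => reflect_if (0 <= mid x) (p x)).
Proof.
move=> mp1 mp2; apply: measurable_fun_ifT => //; apply/measurable_fun_pairP;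
  by split => //=; exact: measurable_funB.
Qed.

Lemma measurable_two_step_src i :
  measurable_fun setT (fun x => two_step_src (lo x) (mid x) (hi x) i).
Proof.
by apply: measurable_reflect; case: i => [|[|[|[|[|i]]]]] /=; measurable_poly.
Qed.

Lemma measurable_two_step_tgt i :
  measurable_fun setT (fun x => two_step_tgt (lo x) (mid x) (hi x) i).
Proof.
by apply: measurable_reflect; case: i => [|[|[|[|[|i]]]]] /=; measurable_poly.
Qed.

End measurability.

(** As [t1 < t2], the points [lo], [mid], [hi] are [t1], [m], [t2] in increasing order. The two
    smallest add up to at most [t1 + m < 0] and the two largest to at least [t2 + m >= 0], which
    bounds [mid] in absolute value. *)
Lemma median_bounds m t1 t2 : -1 <= m -> m <= 1 ->
  -1 <= t1 -> t1 < - m -> - m <= t2 -> t2 <= 1 ->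
  let lo := Num.min t1 m in let hi := Num.max t2 m in
  let mid := Num.max t1 (Num.min m t2) in
  [/\ -1 <= lo, `|mid| <= - lo, `|mid| <= hi & hi <= 1].
Proof.
move=> m1 m2 t11 t1m t2m t21 lo hi mid; rewrite !ler_norml /lo /hi /mid.
rewrite !minEle !maxEle.
by case: (leP m t2) => ?; case: (leP t1 m) => ?; case: (leP t2 m) => ?;
  do ?[case: ifPn; rewrite -?ltNge => ?]; split; try lra; apply/andP; split; lra.
Qed.

(** On the right, each slice is weighted by the absolute moment of the other; [e1] and [e2] are the
    signs of [t1 - m] and [t2 - m], arbitrary at [0]. If [m] lies between [t1] and [t2] the slices
    abut at [m]; otherwise one contains the other and the heights add up on the shorter. Either way
    the break point is the median. *)
Lemma median_densities m t1 t2 e1 e2 (psi : R -> R) :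
  e1 * (t1 - m) = `|t1 - m| -> e2 * (t2 - m) = `|t2 - m| ->
  t1 < - m -> - m <= t2 ->
  let lo := Num.min t1 m in let hi := Num.max t2 m in
  let mid := Num.max t1 (Num.min m t2) in
  (hi ^+ 2 - mid ^+ 2) * (psi (1 + mid) - psi (1 + lo)) +
  (lo ^+ 2 - mid ^+ 2) * (psi (1 + hi) - psi (1 + mid)) =
  e2 * (t2 - m) * (t2 + m) * (e1 * (psi (1 + t1) - psi (1 + m))) -
  e1 * (t1 - m) * (t1 + m) * (e2 * (psi (1 + t2) - psi (1 + m))).
Proof.
have sgE e t : e * (t - m) = `|t - m| -> t = m \/ t < m /\ e = -1 \/ m < t /\ e = 1.
  have [tm|tm|->] := ltgtP t m; last by left.
  - rewrite ltr0_norm ?subr_lt0// => h; right; left; split => //.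
    by apply: (@mulIf _ (t - m)); rewrite ?subr_eq0 ?lt_eqF// mulN1r.
  - rewrite gtr0_norm ?subr_gt0// => h; right; right; split => //.
    by apply: (@mulIf _ (t - m)); rewrite ?subr_eq0 ?gt_eqF// mul1r.
move=> /sgE s1 /sgE s2 t1m t2m lo hi mid; rewrite /lo /hi /mid => {lo hi mid}.
rewrite !minEle !maxEle.
case: s1 => [E1|[[lt1 E1]|[gt1 E1]]]; case: s2 => [E2|[[lt2 E2]|[gt2 E2]]];
  rewrite E1 E2 in t1m t2m *.
all: case: (leP m t2) => ?; case: (leP t1 m) => ?; case: (leP t2 m) => ?;
  try lra; rewrite ?lexx.
all: do ?[case: ifPn; rewrite -?ltNge => ?]; try lra; try ring.
Qed.

End two_step_family.

(** * Horizontal layers of a unimodal density *)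

Section layer_cake.
Context {R : realType}.
Local Notation leb := (@lebesgue_measure R).

Lemma integral_id (c d : R) : c <= d ->
  (\int[leb]_(x in `[c, d]) x%:E = ((d ^+ 2 - c ^+ 2) / 2)%:E)%E.
Proof.
rewrite le_eqVlt => /predU1P[->|cd].
  by rewrite set_itv1 integral_set1 subrr mul0r.
rewrite (@continuous_FTC2 _ id (fun x => x ^+ 2 / 2))//.
- by rewrite -EFinB -mulrBl.
- by apply: continuous_subspaceT => x; exact: cvg_id.
- have cF : continuous (fun x : R => x ^+ 2 / 2).
    by move=> x; apply: cvgMl; exact: exprn_continuous.
  split => [x _| |]; first by apply: derivableM => //; exact: exprn_derivable.
  + by apply: cvg_at_right_filter; exact: cF.
  + by apply: cvg_at_left_filter; exact: cF.
- move=> x _; rewrite derive1E derive_val !scaler0 add0r.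
  by rewrite /GRing.scale/= mulr1; field.
Qed.

Lemma integral_if_in d (T : measurableType d) (nu : {measure set T -> \bar R})
    (D : set T) (b : T -> bool) (g : T -> \bar R) :
  (forall x, b x <-> D x) ->
  (\int[nu]_x (if b x then g x else 0) = \int[nu]_(x in D) g x)%E.
Proof.
move=> bD; rewrite [RHS]integral_mkcond; apply: eq_integral => x _.
rewrite patchE; case: ifPn => [/bD xD|/negP bx]; first by rewrite mem_set.
by rewrite memNset// => /bD.
Qed.

Lemma integral_if_itv (c d : R) (v : \bar R) : (0 <= v)%E ->
  (c <= d)%R ->
  (\int[leb]_y (if (c <= y)%R && (y < d)%R then v else 0) = v * (d - c)%:E)%E.
Proof.
move=> v0 cd; rewrite (@integral_if_in _ _ leb `[c, d[
  (fun y => (c <= y) && (y < d)) (cst v)); last first.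
  by move=> x; rewrite /= in_itv.
rewrite integral_cst//= lebesgue_measure_itv/= lte_fin.
by move: cd; rewrite le_eqVlt => /predU1P[->|->//]; rewrite ltxx subrr.
Qed.

(** Write [q x] as the length of the heights from [0] to [q x] and exchange the integrals by
    Tonelli. *)
Lemma integral_undergraph
    (nu : {sigma_finite_measure set (measurableTypeR R) -> \bar R})
    (q : R -> R) : measurable_fun setT q -> (forall x, 0 <= q x) ->
  (\int[nu]_x (q x)%:E =
   \int[leb]_y \int[nu]_x (if (0 <= y)%R && (y < q x)%R then 1 else 0))%E.
Proof.
move=> mq q0.
pose g (z : measurableTypeR R * measurableTypeR R) : \bar R :=
  if (0 <= z.2) && (z.2 < q z.1) then 1%E else 0%E.
have mg : measurable_fun setT g.
  apply: measurable_fun_ifT => //; apply: measurable_and.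
    by apply: measurable_fun_ler => //; exact: measurable_snd.
  apply: measurable_fun_ltr; first exact: measurable_snd.
  by apply: (measurableT_comp mq); exact: measurable_fst.
rewrite -(fubini_tonelli (m1 := nu) (m2 := leb) g)//; last first.
  by move=> z; rewrite /g; case: ifP.
apply: eq_integral => x _; rewrite /g/=.
by rewrite integral_if_itv// mul1e subr0.
Qed.

Variables (F : probability (measurableTypeR R) R) (f : R -> R).
Hypothesis Ff : is_density F f.

Let mf : measurable_fun setT f. Proof. by have [] := Ff. Qed.
Let f0 x : 0 <= f x. Proof. by have [] := Ff. Qed.
Let FE A : measurable A -> F A = (\int[leb]_(x in A) (f x)%:E)%E.
Proof. by have [_ _] := Ff; apply. Qed.

(** Cutting [q] into horizontal layers reduces the claim to the superlevel sets of [q], where it is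
    the definition of a density. *)
Lemma integral_density (q : R -> R) : measurable_fun setT q -> (forall x, 0 <= q x) ->
  (\int[F]_x (q x)%:E = \int[leb]_x (q x * f x)%R%:E)%E.
Proof.
move=> mq q0; rewrite integral_undergraph//.
pose g (z : measurableTypeR R * measurableTypeR R) : \bar R :=
  if (0 <= z.2) && (z.2 < q z.1) then (f z.1)%:E else 0%E.
have mqy (y : R) : measurable [set x | q x > y].
  rewrite -[X in measurable X]setTI.
  have -> : [set x | q x > y] = q @^-1` `]y, +oo[.
    by apply/seteqP; split => x /=; rewrite in_itv/= andbT.
  exact: mq.
have mg : measurable_fun setT g.
  apply: measurable_fun_ifT => //.
    apply: measurable_and.
      by apply: measurable_fun_ler => //; exact: measurable_snd.
    apply: measurable_fun_ltr; first exact: measurable_snd.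
    by apply: (measurableT_comp mq); exact: measurable_fst.
  apply/measurable_EFinP.
  by apply: (measurableT_comp mf); exact: measurable_fst.
transitivity (\int[leb]_y \int[leb]_x g (x, y))%E.
  apply: eq_integral => y _; have [y0|y0] := leP 0 y; last first.
    by rewrite !integral0_eq// => x _; rewrite /g/= leNgt y0.
  have mD : measurable [set x | y < q x] := mqy y.
  transitivity (F [set x | y < q x]).
    rewrite -[RHS]mul1e -integral_cst//; apply: (@integral_if_in _ _ F _ _ (cst 1%E)).
    by [].
  transitivity (\int[leb]_x (if (y < q x)%R then (f x)%:E else 0%E))%E.
    rewrite FE//; apply/esym.
    by apply: (@integral_if_in _ _ leb [set x | y < q x] (fun x => y < q x)
      (fun x => (f x)%:E)).
  by apply: eq_integral => x _; rewrite /g/= y0.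
rewrite -(fubini_tonelli (m1 := leb) (m2 := leb) g)//; last first.
  by move=> z; rewrite /g; case: ifP => //; rewrite lee_fin.
apply: eq_integral => x _; rewrite /g/=.
by rewrite integral_if_itv ?lee_fin// subr0 muleC.
Qed.

End layer_cake.

(** * Superlevel sets on each side of the mode *)

Section unimodal_layers.
Context {R : realType}.
Local Notation leb := (@lebesgue_measure R).

Lemma superlevel_end (g : R -> R) (x0 M : R) : x0 <= M ->
  (forall x y, x0 <= x -> x <= y -> g y <= g x) -> (forall x, M < x -> g x = 0) ->
  exists r : R -> R, [/\ nonincreasing_fun r,
    forall h, x0 <= r h /\ r h <= M,
    forall h x, x0 < x -> x < r h -> h < g x &
    forall h x, 0 <= h -> r h < x -> g x <= h].
Proof.
move=> x0M gdec gM.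
(* Adding [x0] keeps the set nonempty at great heights, and the bound [M] keeps it bounded at
   negative ones. *)
pose S (h : R) := x0 |` [set x | [/\ x0 <= x, x <= M & h < g x]].
have S0 h : S h !=set0 by exists x0; left.
have SM h : ubound (S h) M by move=> x [->|[]].
have Sub h : has_ubound (S h) by exists M.
have Sx0 h : x0 <= sup (S h) by apply: (ub_le_sup (Sub h)); left.
exists (fun h => sup (S h)); split => [h k hk|h|h x x0x xs|h x h0 sx].
- apply: ge_sup => // x [->|[x0x xM kg]]; first exact: Sx0.
  by apply: (ub_le_sup (Sub h)); right; split => //; exact: le_lt_trans kg.
- by split => //; exact: ge_sup.
- have [y Sy xy] := sup_gt (S0 h) xs.
  case: Sy => [yx0|[x0y _ hy]]; first by move: (lt_trans x0x xy); rewrite yx0 ltxx.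
  by apply: (lt_le_trans hy); apply: gdec; exact: ltW.
- rewrite leNgt; apply/negP => hg.
  have [xM|Mx] := leP x M; last by move: hg; rewrite gM// ltNge h0.
  have : x <= sup (S h).
    apply: (ub_le_sup (Sub h)); right; split => //.
    by rewrite (le_trans (Sx0 h))// ltW.
  by rewrite leNgt sx.
Qed.

(** An interval outside [[0, 2]] is null for [F], so [f] has a zero in it, and monotonicity spreads
    this zero away from the mode. A mode outside [[0, 2]] would spread it over [[0, 2]] instead,
    against the total mass. *)
Lemma unimodal_support (F : probability (measurableTypeR R) R) (f : R -> R) :
  is_density F f -> unimodal f -> F `[0, 2]%classic = 1%E ->
  exists x0 : R, [/\ 0 <= x0 <= 2,
    forall x y, x <= y -> y <= x0 -> f x <= f y,
    forall x y, x0 <= x -> x <= y -> f y <= f x &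
    forall x, ~~ (0 <= x <= 2) -> f x = 0].
Proof.
move=> [mf f0 FE] [x0 [finc fdec]] F1.
have Fout : F (~` `[0, 2]) = 0%E.
  by rewrite probability_setC// F1 subee.
have zero (u v : R) : u < v -> `]u, v[ `<=` ~` `[0, 2] ->
    exists2 z, u < z < v & f z = 0.
  move=> uv uvC.
  have Fuv : F `]u, v[%classic = 0%E.
    apply: (@subset_measure0 _ _ _ F `]u, v[%classic (~` `[0, 2])) => //.
    exact: measurableC.
  apply: contrapT => /forall2NP noz.
  have : ae_eq leb `]u, v[%classic (EFin \o f) (cst 0%E).
    apply/ae_eq_integral_abs => //; first exact/measurable_EFinP/measurable_funTS.
    rewrite -[RHS]Fuv FE//; apply: eq_integral => x _ /=.
    by rewrite ger0_norm.
  move=> [N [mN N0 subN]].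
  suff : (leb `]u, v[%classic <= leb N)%E.
    by rewrite N0 lebesgue_measure_itv/= lte_fin uv -EFinD lee_fin; lra.
  apply: le_measure; rewrite ?inE//; apply: subset_trans subN => z/=.
  rewrite in_itv/= => zuv /(_ zuv) [fz0].
  by have [|] := noz z.
have x0ge0 : 0 <= x0.
  rewrite leNgt; apply/negP => x00.
  have [|z zx fz0] := zero x0 0 x00.
    by move=> x /=; rewrite !in_itv/= => ? /andP[]; lra.
  suff : F `[0, 2]%classic = 0%E by rewrite F1 => /eqP; rewrite onee_eq0.
  rewrite FE// integral0_eq// => x /=; rewrite in_itv/= => x02; congr EFin.
  by apply/eqP; rewrite eq_le f0 andbT -fz0; apply: fdec; lra.
have x0le2 : x0 <= 2.
  rewrite leNgt; apply/negP => x00.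
  have [|z zx fz0] := zero 2 x0 x00.
    by move=> x /=; rewrite !in_itv/= => ? /andP[]; lra.
  suff : F `[0, 2]%classic = 0%E by rewrite F1 => /eqP; rewrite onee_eq0.
  rewrite FE// integral0_eq// => x /=; rewrite in_itv/= => x02; congr EFin.
  by apply/eqP; rewrite eq_le f0 andbT -fz0; apply: finc; lra.
exists x0; split => //; first by rewrite x0ge0.
move=> x xout; apply/eqP; rewrite eq_le f0 andbT.
have [x0'|x0'] := ltP x 0.
  have [|z zx fz0] := zero x 0 x0'.
    by move=> y /=; rewrite !in_itv/= => ? /andP[]; lra.
  by rewrite -fz0; apply: finc; lra.
have x2 : 2 < x by rewrite ltNge; move: xout; rewrite x0'.
have [|z zx fz0] := zero 2 x x2.
  by move=> y /=; rewrite !in_itv/= => ? /andP[]; lra.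
by rewrite -fz0; apply: fdec; lra.
Qed.

(** Heights [h >= 0] index the slices to the right of the mode and heights [h < 0] those to its
    left, so that a single Lebesgue variable covers both. *)
Definition side (h : R) : R := if 0 <= h then 1 else -1.

Lemma measurable_side : measurable_fun setT side.
Proof. by apply: measurable_fun_ifT => //; exact: measurable_fun_ler. Qed.

(** [T h] is the far end of the slice at height [|h|]. The left half comes from the right one by the
    reflection of [x] into [2 - x], and the integral formula is Tonelli on the region [E]. *)
Lemma unimodal_layers (f : R -> R) (x0 : R) :
  measurable_fun setT f -> (forall x, 0 <= f x) -> 0 <= x0 <= 2 ->
  (forall x y, x <= y -> y <= x0 -> f x <= f y) ->
  (forall x y, x0 <= x -> x <= y -> f y <= f x) ->
  (forall x, ~~ (0 <= x <= 2) -> f x = 0) ->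
  exists T : R -> R, [/\ measurable_fun setT T,
    forall h, 0 <= T h <= 2,
    forall h, side h * (T h - x0) = `|T h - x0| &
    forall q : R -> R, measurable_fun setT q -> (forall x, 0 <= q x) ->
      (\int[leb]_h \int[leb]_(x in `[Num.min x0 (T h), Num.max x0 (T h)]) (q x)%:E =
       \int[leb]_x (q x * f x)%R%:E)%E].
Proof.
move=> mf f0 /andP[x00 x02] finc fdec fout.
have [r [rdec rb rlt rgt]] : exists r : R -> R, [/\ nonincreasing_fun r,
    forall h, x0 <= r h /\ r h <= 2,
    forall h x, x0 < x -> x < r h -> h < f x &
    forall h x, 0 <= h -> r h < x -> f x <= h].
  by apply: superlevel_end => // x x2; apply: fout; rewrite (leNgt x) x2 andbF.
have [l [ldec lb llt lgt]] : exists r : R -> R, [/\ nonincreasing_fun r,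
    forall h, 2 - x0 <= r h /\ r h <= 2,
    forall h x, 2 - x0 < x -> x < r h -> h < f (2 - x) &
    forall h x, 0 <= h -> r h < x -> f (2 - x) <= h].
  apply: (@superlevel_end (fun x => f (2 - x))); first lra.
    by move=> x y ? ?; apply: finc; lra.
  by move=> x x2; apply: fout; apply/negP => /andP[]; lra.
pose T h := if 0 <= h then r h else 2 - l (- h).
have T_pos h : 0 <= h -> T h = r h by rewrite /T => ->.
have T_neg h : h < 0 -> T h = 2 - l (- h) by rewrite /T leNgt => ->.
exists T; split.
- apply: measurable_fun_ifT; first exact: measurable_fun_ler.
    exact: nonincreasing_measurable.
  apply: nonincreasing_measurable => // h k hk.
  by rewrite lerB// ldec// lerN2.
- move=> h; have [h0|h0] := leP 0 h.
    by rewrite T_pos//; have [] := rb h; lra.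
  by rewrite T_neg//; have [] := lb (- h); lra.
- move=> h; rewrite /side; have [h0|h0] := leP 0 h.
    by rewrite T_pos// mul1r ger0_norm// subr_ge0; have [] := rb h.
  rewrite T_neg// mulN1r ler0_norm//.
  by have [] := lb (- h); lra.
move=> q mq q0.
(* The region under the graph, with the part left of [x0] turned below the axis, so that the sign of
   the height tells the sides apart. *)
pose E (z : measurableTypeR R * measurableTypeR R) : bool :=
  if x0 <= z.2 then (0 <= z.1) && (z.1 < f z.2) else (- f z.2 < z.1) && (z.1 < 0).
pose g (z : measurableTypeR R * measurableTypeR R) : \bar R :=
  if E z then (q z.2)%:E else 0%E.
have m1 : measurable_fun setT (fst : measurableTypeR R * measurableTypeR R -> R).
  exact: measurable_fst.
have m2 : measurable_fun setT (snd : measurableTypeR R * measurableTypeR R -> R).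
  exact: measurable_snd.
have mf2 : measurable_fun setT (fun z : measurableTypeR R * measurableTypeR R => f z.2).
  exact: (measurableT_comp mf).
have mE : measurable_fun setT E.
  apply: measurable_fun_ifT; first exact: measurable_fun_ler.
    by apply: measurable_and; [exact: measurable_fun_ler|exact: measurable_fun_ltr].
  apply: measurable_and; apply: measurable_fun_ltr => //.
  exact: measurable_funN.
have mg : measurable_fun setT g.
  apply: measurable_fun_ifT => //; apply/measurable_EFinP.
  exact: (measurableT_comp mq).
have g0 z : (0 <= g z)%E by rewrite /g; case: ifP => //; rewrite lee_fin.
transitivity (\int[leb]_h \int[leb]_x g (h, x))%E; last first.
  rewrite (fubini_tonelli (m1 := leb) (m2 := leb) g)//.
  apply: eq_integral => x _; rewrite /g /E/=.
  have [x0x|xx0] := leP x0 x.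
    by rewrite integral_if_itv ?lee_fin// subr0 EFinM.
  transitivity (\int[leb]_(h in `](- f x)%R, 0%R[) (cst (q x)%:E) h)%E.
    apply: (@integral_if_in _ _ _ leb _ _ (cst (q x)%:E)).
    by move=> h /=; rewrite in_itv.
  rewrite integral_cst//= lebesgue_measure_itv/= lte_fin oppr_lt0.
  rewrite add0e opprK EFinM; case: ifPn => //; rewrite -leNgt => fx0.
  by have -> : f x = 0 by apply/eqP; rewrite eq_le f0 fx0.
apply: eq_integral => h _.
rewrite -(@integral_if_in _ _ _ leb _
  (fun x => (Num.min x0 (T h) <= x) && (x <= Num.max x0 (T h))) (EFin \o q))//.
apply: ge0_ae_eq_integral => //.
- apply: measurable_fun_ifT.
    by apply: measurable_and; exact: measurable_fun_ler.
  + exact/measurable_EFinP.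
  + exact: measurable_cst.
- exact: (measurableT_comp mg (measurable_pair1 h)).
- by move=> x _; case: ifP => //; rewrite lee_fin.
(* Away from these two points, where the superlevel bounds are silent, the section of [E] at height
   [h] is the interval between [x0] and [T h]. *)
exists [set x0; T h]; split.
- by apply: measurableU; exact: measurable_set1.
- transitivity (leb [set x0]); last exact: lebesgue_measure_set1.
  by apply: measureU0; [exact: measurable_set1..|exact: lebesgue_measure_set1].
move=> x /= /not_implyP[_]; apply: contra_notP => /not_orP[xx0 xT].
have {}xx0 : x != x0 by apply/eqP.
have {}xT : x != T h by apply/eqP.
rewrite /g /=; congr (if _ then _ else _); rewrite /E /=.
have [h0|h0] := leP 0 h.
- rewrite T_pos// in xT *; have [rb1 rb2] := rb h.
  rewrite min_l// max_r//; have [x0x|//] := leP x0 x; last by rewrite andbF.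
  have {}x0x : x0 < x by rewrite lt_neqAle eq_sym xx0.
  have [xr|rx] := leP x (r h); last by apply/esym/negbTE; rewrite -leNgt rgt.
  by rewrite rlt// lt_neqAle xT.
- rewrite T_neg// in xT *; have [lb1 lb2] := lb (- h).
  rewrite min_r ?max_l//; [|lra..].
  rewrite andbT leNgt; have [x0x|xltx0] := leP x0 x.
    by rewrite leNgt (lt_neqAle x0) eq_sym xx0 x0x andbF.
  rewrite (ltW xltx0) andbT; have [Tx|xT'] := ltP x (2 - l (- h)).
    apply/esym/negbTE; rewrite -leNgt -(opprK h) lerN2.
    by have := lgt (- h) (2 - x); rewrite subKr; apply; lra.
  apply/esym; rewrite -(opprK h) ltrN2.
  have Tx : 2 - l (- h) < x by rewrite lt_neqAle eq_sym xT.
  by have := llt (- h) (2 - x); rewrite subKr; apply; lra.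
Qed.

End unimodal_layers.

(** * Pairing the layers *)

Section assembly.
Context {R : realType}.
Local Notation leb := (@lebesgue_measure R).

Lemma signed_len_nondecreasing (A : set R) : measurable A ->
  {homo signed_len A : x y / x <= y}.
Proof.
by move=> mA x y xy; rewrite -subr_ge0 signed_lenB// fine_ge0 ?measure_ge0.
Qed.

Lemma integral_prod_mul d1 d2 (T1 : measurableType d1) (T2 : measurableType d2)
    (m1 : {sigma_finite_measure set T1 -> \bar R})
    (m2 : {sigma_finite_measure set T2 -> \bar R}) (a : T1 -> R) (b : T2 -> R) :
  measurable_fun setT a -> measurable_fun setT b ->
  (forall x, 0 <= a x) -> (forall x, 0 <= b x) ->
  (\int[m1 \x m2]_z (a z.1 * b z.2)%R%:E =
   \int[m1]_x (a x)%:E * \int[m2]_y (b y)%:E)%E.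
Proof.
move=> ma mb a0 b0; rewrite fubini_tonelli1/=; last 2 first.
- apply/measurable_EFinP; apply: measurable_funM.
    by apply: (measurableT_comp ma); exact: measurable_fst.
  by apply: (measurableT_comp mb); exact: measurable_snd.
- by move=> z; rewrite lee_fin mulr_ge0.
rewrite /fubini_F/= -ge0_integralZr//; last 3 first.
- exact/measurable_EFinP.
- by move=> x _; rewrite lee_fin.
- by apply: integral_ge0 => y _; rewrite lee_fin.
apply: eq_integral => x _; rewrite -ge0_integralZl//; last 3 first.
- exact/measurable_EFinP.
- by move=> y _; rewrite lee_fin.
- by rewrite lee_fin.
Qed.

(* The sides of the triangle with vertices (1 - L, 0), (1, L) and (0, 1), weighted
   so that the coordinate sum is uniform on [1 - L, 1 + L]. *)
Definition triangle_weight (L : R) (i : nat) : R :=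
  2 * L / (2 - L) * (if i is 0 then L else 1 - L).

Definition triangle_src (L : R) (i : nat) : R * R :=
  if i is 2 then (1, L) else (1 - L, 0).

Definition triangle_tgt (L : R) (i : nat) : R * R :=
  if i is 0 then (1, L) else (0, 1).

Lemma triangle_marginals c L (I : R -> R -> R) psi : chord I psi ->
  \sum_(i < 3) c * triangle_weight L i *
    (I (triangle_src L i).1 (triangle_tgt L i).1 +
     I (triangle_src L i).2 (triangle_tgt L i).2) =
  2 * (\sum_(i < 3) c * triangle_weight L i) * (psi 1 - psi 0).
Proof.
move=> ch; rewrite !big_ord_recl !big_ord0 /triangle_weight /=.
transitivity (c * (2 * L / (2 - L)) * ((1 - (1 - L)) * I (1 - L) 1 + (L - 0) * I 0 L
  - (0 - (1 - L)) * I (1 - L) 0 + (1 - L) * ((1 - 0) * I 0 1)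
  - (1 - L) * ((0 - 1) * I 1 0) + (1 - L) * I L 1)); first by ring.
by rewrite !ch; ring.
Qed.

Lemma triangle_sum L (I : R -> R -> R) psi : chord I psi -> L != 2 ->
  \sum_(i < 3) triangle_weight L i *
    I ((triangle_src L i).1 + (triangle_src L i).2)
      ((triangle_tgt L i).1 + (triangle_tgt L i).2) =
  psi (1 + L) - psi (1 - L).
Proof.
move=> ch L2; rewrite !big_ord_recl !big_ord0 /triangle_weight /= !addr0 !add0r.
have L2' : 2 - L != 0 by rewrite subr_eq0 eq_sym.
apply: (mulfI L2').
transitivity (L * ((1 + L - (1 - L)) * I (1 - L) (1 + L))
  + 2 * (1 - L) * ((1 - (1 - L)) * I (1 - L) 1 - (1 - (1 + L)) * I (1 + L) 1)).
  by field.
by rewrite !ch; ring.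
Qed.

Variables (F : probability (measurableTypeR R) R) (x0 : R) (T : R -> R).
Hypothesis x02 : 0 <= x0 <= 2.
Hypotheses (mT : measurable_fun setT T) (T02 : forall h, 0 <= T h <= 2).
Hypothesis sideT : forall h, side h * (T h - x0) = `|T h - x0|.

Let layer (A : set R) h := side h * (signed_len A (T h) - signed_len A x0).

Let layer_ge0 A h : measurable A -> 0 <= layer A h.
Proof.
move=> mA; rewrite /layer /side; have := sideT h; rewrite /side.
have sl := signed_len_nondecreasing mA.
case: ifP => _; [rewrite !mul1r|rewrite !mulN1r] => sT.
  by have := sl x0 (T h); rewrite subr_ge0; apply; rewrite -subr_ge0 sT.
have := sl (T h) x0; rewrite oppr_ge0 subr_le0; apply.
by rewrite -subr_le0 -oppr_ge0 sT.
Qed.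

Let measurable_layer A : measurable A -> measurable_fun setT (layer A).
Proof.
move=> mA; apply: measurable_funM; first exact: measurable_side.
apply: measurable_funB => //; apply: measurableT_comp => //.
by apply: nondecreasing_measurable => //; exact: signed_len_nondecreasing.
Qed.

Hypothesis F_layers : forall A, measurable A ->
  F A = (\int[leb]_h (layer A h)%:E)%E.

(* Twice the first moment about [1] of the layer [h]. *)
Let moment h := side h * (T h - x0) * (T h + x0 - 2).
(** The midpoint of the slice lies left of [1], so its moment is at most [0]. *)
Let low h := T h + x0 < 2.
Let lowm h := if low h then - moment h else 0.
Let highm h := if low h then 0 else moment h.

Hypothesis balanced : (\int[leb]_h (lowm h)%:E = \int[leb]_h (highm h)%:E)%E.
Hypothesis balanced_fin : (\int[leb]_h (lowm h)%:E < +oo)%E.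

Let measurable_low : measurable_fun setT low.
Proof. by apply: measurable_fun_ltr => //; exact: measurable_funD. Qed.

Let measurable_moment : measurable_fun setT moment.
Proof.
apply: measurable_funM.
  by apply: measurable_funM; [exact: measurable_side|exact: measurable_funB].
by apply: measurable_funB => //; exact: measurable_funD.
Qed.

Let measurable_lowm : measurable_fun setT lowm.
Proof. by apply: measurable_fun_ifT => //; exact: measurable_funN. Qed.

Let measurable_highm : measurable_fun setT highm.
Proof. exact: measurable_fun_ifT. Qed.

Let lowm_ge0 h : 0 <= lowm h.
Proof.
rewrite /lowm /low /moment; case: ifPn => // lth.
by rewrite sideT -mulrN mulr_ge0// oppr_ge0; lra.
Qed.

Let highm_ge0 h : 0 <= highm h.
Proof.
rewrite /highm /low /moment; case: ifPn => //; rewrite -leNgt => leh.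
by rewrite sideT mulr_ge0//; lra.
Qed.

Let M := fine (\int[leb]_h (lowm h)%:E)%E.

Let ME : (\int[leb]_h (lowm h)%:E)%E = M%:E.
Proof.
by rewrite /M fineK// ge0_fin_numE// integral_ge0// => h _; rewrite lee_fin.
Qed.

Let plane := (measurableTypeR R * measurableTypeR R)%type.
Let t1 (z : plane) := T z.1 - 1.
Let t2 (z : plane) := T z.2 - 1.
Let lo z := Num.min (t1 z) (x0 - 1).
Let hi z := Num.max (t2 z) (x0 - 1).
Let mid z := Num.max (t1 z) (Num.min (x0 - 1) (t2 z)).

Let mt1 : measurable_fun setT t1.
Proof.
by apply: measurable_funB => //; apply: (measurableT_comp mT); exact: measurable_fst.
Qed.

Let mt2 : measurable_fun setT t2.
Proof.
by apply: measurable_funB => //; apply: (measurableT_comp mT); exact: measurable_snd.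
Qed.

Let mlo : measurable_fun setT lo. Proof. exact: measurable_minr. Qed.
Let mhi : measurable_fun setT hi. Proof. exact: measurable_maxr. Qed.
Let mmid : measurable_fun setT mid.
Proof. by apply: measurable_maxr => //; exact: measurable_minr. Qed.

(** Weighting a slice by the moment of its partner and integrating over all partners yields the
    factor [M], on either side by balance; [M^-1] removes it. *)
Let pairing (z : plane) := if low z.1 && ~~ low z.2 then M^-1 else 0.

Let measurable_pairing : measurable_fun setT pairing.
Proof.
apply: measurable_fun_ifT => //; apply: measurable_and.
  by apply: (measurableT_comp measurable_low); exact: measurable_fst.
apply: measurable_neg.
by apply: (measurableT_comp measurable_low); exact: measurable_snd.
Qed.

Let pairing_bounds z : low z.1 && ~~ low z.2 ->
  [/\ -1 <= lo z, `|mid z| <= - lo z, `|mid z| <= hi z & hi z <= 1].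
Proof.
rewrite /low -leNgt => /andP[l1 l2].
have T1 := T02 z.1; have T2 := T02 z.2.
by apply: median_bounds; rewrite /t1 /t2; lra.
Qed.

Let D2U_unbalanced : M != 0 -> D2U F.
Proof.
move=> M0.
have M_gt0 : 0 < M.
  by rewrite lt0r M0 fine_ge0// integral_ge0// => h _; rewrite lee_fin.
apply: (@D2U_of_segments _ _ _ (leb \x leb)%E 5
  (fun i z => pairing z * two_step_weight (lo z) (mid z) (hi z) i)
  (fun i z => two_step_src (lo z) (mid z) (hi z) i)
  (fun i z => two_step_tgt (lo z) (mid z) (hi z) i)).
- by move=> i; apply: measurable_funM => //; exact: measurable_two_step_weight.
- by move=> i; exact: measurable_two_step_src.
- by move=> i; exact: measurable_two_step_tgt.
- move=> i z; rewrite /pairing; case: ifPn => [lz|_]; last by rewrite mul0r.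
  apply: mulr_ge0; first by rewrite invr_ge0 ltW.
  by have [? ? ? ?] := pairing_bounds lz; exact: two_step_weight_ge0.
- by move=> z I psi ch; exact: two_step_marginals.
move=> A mA.
pose lowl h := if low h then layer A h else 0.
pose highl h := if low h then 0 else layer A h.
have lowl_ge0 h : 0 <= lowl h by rewrite /lowl; case: ifP => // _; exact: layer_ge0.
have highl_ge0 h : 0 <= highl h by rewrite /highl; case: ifP => // _; exact: layer_ge0.
have mlowl : measurable_fun setT lowl.
  by apply: measurable_fun_ifT => //; exact: measurable_layer.
have mhighl : measurable_fun setT highl.
  by apply: measurable_fun_ifT => //; exact: measurable_layer.
(* By [median_densities] the integrand splits into two products of a function of [z.1] and one of
   [z.2]. In each, the moment factor integrates to [1], which leaves all low and all high layers. *)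
transitivity (\int[leb \x leb]_z ((lowl z.1 * (M^-1 * highm z.2))%R%:E +
    ((M^-1 * lowm z.1) * highl z.2)%R%:E))%E.
  apply: eq_integral => z _; rewrite -EFinD; congr EFin.
  under eq_bigr do rewrite -mulrA.
  rewrite -mulr_sumr /pairing /lowl /highl /highm /lowm.
  case: (boolP (low z.1)) => l1; last by rewrite /= !mul0r !(mulr0, mul0r) add0r.
  case: (boolP (low z.2)) => l2; first by rewrite /= !(mulr0, mul0r) addr0.
  have lz : low z.1 && ~~ low z.2 by rewrite l1.
  have [lo1 mlo' mhi' hi1] := pairing_bounds lz.
  rewrite /= (two_step_sum (chord_segment_len mA))//.
  rewrite (@median_densities _ _ _ _ (side z.1) (side z.2)); last 4 first.
  - by rewrite /t1 (_ : _ - 1 - _ = T z.1 - x0) ?sideT//; ring.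
  - by rewrite /t2 (_ : _ - 1 - _ = T z.2 - x0) ?sideT//; ring.
  - by rewrite /t1; move: l1; rewrite /low; lra.
  - by rewrite /t2; move: l2; rewrite /low -leNgt; lra.
  rewrite /t1 /t2 /moment /layer.
  have E1 x : 1 + (x - 1) = x :> R by ring.
  by rewrite !E1; ring.
have mf1 (a : R -> R) : measurable_fun setT a ->
    measurable_fun setT (fun z : plane => a z.1).
  by move=> ma; apply: (measurableT_comp ma); exact: measurable_fst.
have mf2 (a : R -> R) : measurable_fun setT a ->
    measurable_fun setT (fun z : plane => a z.2).
  by move=> ma; apply: (measurableT_comp ma); exact: measurable_snd.
have Mhighm : (\int[leb]_h (M^-1 * highm h)%R%:E = 1)%E.
  under eq_integral do rewrite EFinM.
  rewrite ge0_integralZl//; last 3 first.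
  - exact/measurable_EFinP.
  - by move=> h _; rewrite lee_fin.
  - by rewrite lee_fin invr_ge0 ltW.
  by rewrite -balanced ME -EFinM mulVf.
have Mlowm : (\int[leb]_h (M^-1 * lowm h)%R%:E = 1)%E.
  under eq_integral do rewrite EFinM.
  rewrite ge0_integralZl//; last 3 first.
  - exact/measurable_EFinP.
  - by move=> h _; rewrite lee_fin.
  - by rewrite lee_fin invr_ge0 ltW.
  by rewrite ME -EFinM mulVf.
have Mhighm_ge0 h : 0 <= M^-1 * highm h by rewrite mulr_ge0// invr_ge0 ltW.
have Mlowm_ge0 h : 0 <= M^-1 * lowm h by rewrite mulr_ge0// invr_ge0 ltW.
have mMhighm : measurable_fun setT (fun h => M^-1 * highm h) by exact: measurable_funM.
have mMlowm : measurable_fun setT (fun h => M^-1 * lowm h) by exact: measurable_funM.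
rewrite ge0_integralD//; last 4 first.
- by move=> z _; rewrite lee_fin mulr_ge0.
- apply/measurable_EFinP; apply: measurable_funM; first exact: (mf1 _ mlowl).
  exact: (mf2 _ mMhighm).
- by move=> z _; rewrite lee_fin mulr_ge0.
- apply/measurable_EFinP; apply: measurable_funM; first exact: (mf1 _ mMlowm).
  exact: (mf2 _ mhighl).
rewrite (integral_prod_mul leb leb mlowl mMhighm)//.
rewrite (integral_prod_mul leb leb mMlowm mhighl)//.
rewrite Mhighm Mlowm mule1 mul1e -ge0_integralD//; last 4 first.
- by move=> z _; rewrite lee_fin.
- exact/measurable_EFinP.
- by move=> z _; rewrite lee_fin.
- exact/measurable_EFinP.
rewrite F_layers//; apply: eq_integral => h _; rewrite -EFinD /lowl /highl.
by case: ifP => _; rewrite ?addr0 ?add0r.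
Qed.

(** Almost every moment vanishes, so almost every slice is degenerate, with [T h = x0], or symmetric
    about [1], with [T h = 2 - x0]. The triangle with [L] the distance from [x0] to [1] carries each
    symmetric slice. *)
Let D2U_balanced : M = 0 -> D2U F.
Proof.
move=> M0; have /andP[x0ge x0le] := x02; pose L := `|x0 - 1|.
have L1 : L <= 1 by rewrite ler_norml; apply/andP; split; lra.
have L0 : 0 <= L := normr_ge0 _.
pose Z h := T h == 2 - x0.
have mZ : measurable_fun setT Z by exact: measurable_fun_eqr.
have ae0 (k : R -> R) : measurable_fun setT k -> (forall h, 0 <= k h) ->
    (\int[leb]_h (k h)%:E = 0)%E -> ae_eq leb setT (EFin \o k) (cst 0%E).
  move=> mk k0 intk; apply/ae_eq_integral_abs => //; first exact/measurable_EFinP.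
  by rewrite -intk; apply: eq_integral => h _ /=; rewrite ger0_norm.
have ael : ae_eq leb setT (EFin \o lowm) (cst 0%E) by apply: ae0 => //; rewrite ME M0.
have aeh : ae_eq leb setT (EFin \o highm) (cst 0%E).
  by apply: ae0 => //; rewrite -balanced ME M0.
pose ind h : R := if Z h then 1 else 0.
have mind : measurable_fun setT ind by exact: measurable_fun_ifT.
refine (@D2U_of_segments R _ _ leb 3 (fun i h => ind h * triangle_weight L i)
  (fun i _ => triangle_src L i) (fun i _ => triangle_tgt L i) _ _ _ _ _ F _) => //.
- by move=> i; exact: measurable_funM.
- move=> i h; apply: mulr_ge0; first by rewrite /ind; case: ifP.
  rewrite /triangle_weight !mulr_ge0 ?invr_ge0//; first lra.
  by case: i => // i; lra.
- by move=> h I psi ch; exact: triangle_marginals.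
move=> A mA; rewrite F_layers//.
have L2 : L != 2 by apply/eqP; lra.
apply: ae_eq_integral => //.
- apply/measurable_EFinP.
  rewrite (_ : (fun _ => _) = fun h =>
      ind h * (signed_len A (1 + L) - signed_len A (1 - L))).
    exact: measurable_funM.
  apply/funext => h; rewrite -(triangle_sum (chord_segment_len mA) L2) mulr_sumr.
  by apply: eq_bigr => i _; rewrite mulrA.
- by apply/measurable_EFinP; exact: measurable_layer.
apply: filterS2 ael aeh => h /(_ Logic.I) [l0] /(_ Logic.I) [h0] _; congr EFin.
have mom0 : moment h = 0.
  move: l0 h0; rewrite /lowm /highm; case: ifP => // _ /eqP.
  by rewrite oppr_eq0 => /eqP.
under eq_bigr do rewrite -mulrA.
rewrite -mulr_sumr (triangle_sum (chord_segment_len mA))//.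
move: mom0; rewrite /moment sideT => /eqP; rewrite mulf_eq0 normr_eq0 subr_eq0.
have sT := sideT h.
rewrite /ind /Z /layer; have [Th _|Th] := eqVneq (T h) (2 - x0); last first.
  case/orP => [/eqP ->|/eqP]; first by rewrite subrr mulr0 mul0r.
  by move/eqP: Th; lra.
rewrite mul1r Th; move: sT; rewrite Th /L /side.
have [x01|x01|->] := ltgtP x0 1; last first.
- have -> : 2 - 1 = 1 :> R by ring.
  by rewrite subrr normr0 addr0 subr0 !subrr mulr0.
- rewrite (ger0_norm (_ : 0 <= x0 - 1)); last lra.
  rewrite ler0_norm; last lra.
  case: ifP => _ h1; first lra.
  have -> : 1 + (x0 - 1) = x0 by ring.
  have -> : 1 - (x0 - 1) = 2 - x0 by ring.
  by ring.
- rewrite (ler0_norm (_ : x0 - 1 <= 0)); last lra.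
  rewrite ger0_norm; last lra.
  case: ifP => _ h1; last lra.
  have -> : 1 + - (x0 - 1) = 2 - x0 by ring.
  have -> : 1 - - (x0 - 1) = x0 by ring.
  by rewrite mul1r.
Qed.

Lemma D2U_of_layers : D2U F.
Proof. by have [/D2U_balanced|/D2U_unbalanced] := eqVneq M 0. Qed.

End assembly.

(** * Total mass and mean of the layers *)

Section unimodal_sum.
Context {R : realType}.
Local Notation leb := (@lebesgue_measure R).

(** Pointwise, the negative part of [k] plus [2 * u] equals its positive part plus [2 * v].
    Integrating nonnegative functions only and cancelling the finite [2] gives the balance; the
    negative part is at most [2 * v], hence integrable. *)
Lemma balanced_moments (low : R -> bool) (u v k : R -> R) :
  measurable_fun setT low -> measurable_fun setT u -> measurable_fun setT v ->
  (forall h, 0 <= u h) -> (forall h, 0 <= v h) ->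
  (forall h, if low h then u h <= v h else v h <= u h) ->
  (forall h, k h = 2 * (u h - v h)) ->
  (\int[leb]_h (u h)%:E = 1)%E -> (\int[leb]_h (v h)%:E = 1)%E ->
  (\int[leb]_h (if low h then - k h else 0)%R%:E =
   \int[leb]_h (if low h then 0 else k h)%R%:E /\
   \int[leb]_h (if low h then - k h else 0)%R%:E < +oo)%E.
Proof.
move=> mlow mu mv u0 v0 uv kE u1 v1.
have mk : measurable_fun setT k.
  rewrite (_ : k = fun h => 2 * (u h - v h)); last exact/funext.
  by apply: measurable_funM => //; exact: measurable_funB.
pose kl h := if low h then - k h else 0; pose kh h := if low h then 0 else k h.
have mkl : measurable_fun setT kl.
  by apply: measurable_fun_ifT => //; exact: measurable_funN.
have mkh : measurable_fun setT kh by exact: measurable_fun_ifT.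
have kl0 h : 0 <= kl h by rewrite /kl; have := uv h; rewrite kE; case: ifP => // _; lra.
have kh0 h : 0 <= kh h by rewrite /kh; have := uv h; rewrite kE; case: ifP => // _; lra.
have intZ (w : R -> R) : measurable_fun setT w -> (forall h, 0 <= w h) ->
    (\int[leb]_h (2 * w h)%R%:E = 2%:E * \int[leb]_h (w h)%:E)%E.
  move=> mw w0; under eq_integral do rewrite EFinM.
  by rewrite ge0_integralZl//; [exact/measurable_EFinP|move=> h _; rewrite lee_fin].
have intD (w1 w2 : R -> R) : measurable_fun setT w1 -> measurable_fun setT w2 ->
    (forall h, 0 <= w1 h) -> (forall h, 0 <= w2 h) ->
    (\int[leb]_h (w1 h + w2 h)%R%:E = \int[leb]_h (w1 h)%:E + \int[leb]_h (w2 h)%:E)%E.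
  move=> mw1 mw2 w10 w20; under eq_integral do rewrite EFinD.
  rewrite ge0_integralD//; [by move=> h _; rewrite lee_fin|exact/measurable_EFinP
    |by move=> h _; rewrite lee_fin|exact/measurable_EFinP].
have m2 (w : R -> R) :
    measurable_fun setT w -> measurable_fun setT (fun h => 2 * w h : R).
  by move=> mw; exact: measurable_funM.
have E : (2%:E + \int[leb]_h (kl h)%:E = 2%:E + \int[leb]_h (kh h)%:E)%E.
  have <- : (\int[leb]_h (2 * u h)%R%:E = 2%:E)%E by rewrite intZ// u1 mule1.
  rewrite -intD//; [|exact: m2|by move=> h; rewrite mulr_ge0].
  have -> : (\int[leb]_h (2 * u h)%R%:E = \int[leb]_h (2 * v h)%R%:E)%E.
    by rewrite !intZ// u1 v1.
  rewrite -intD//; [|exact: m2|by move=> h; rewrite mulr_ge0].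
  apply: eq_integral => h _; congr EFin; rewrite /kl /kh kE.
  by case: ifP => _; ring.
have cancel (a b : \bar R) : (2%:E + a = 2%:E + b -> a = b)%E.
  by move=> ab; rewrite -[a](@addeK _ 2%:E)// (addeC a) ab (addeC 2%:E) addeK.
split; first exact: cancel.
apply: (@le_lt_trans _ _ (\int[leb]_h (2 * v h)%R%:E)%E); last first.
  by rewrite intZ// v1 mule1 ltry.
apply: ge0_le_integral => //.
- by move=> h _; rewrite lee_fin; exact: kl0.
- exact/measurable_EFinP.
- by apply/measurable_EFinP; exact: m2.
- move=> h _; rewrite lee_fin /kl kE; have := u0 h; have := v0 h.
  by case: ifP => _; lra.
Qed.

Lemma D2U_of_unimodal (F : probability (measurableTypeR R) R) (f : R -> R) :
  is_density F f -> unimodal f -> F `[0, 2]%classic = 1%E ->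
  ('E_F[fun x : R => x] = 1)%E -> D2U F.
Proof.
move=> Ff uf F02 mean1.
have [x0 [x02 finc fdec fout]] := unimodal_support Ff uf F02.
have [mf f0 FE] := Ff.
have [T [mT T02 sideT layers]] := unimodal_layers mf f0 x02 finc fdec fout.
(* This trades ordered end points, used for integrals, for the sign [side h], used for the algebra;
   when [T h = x0] both sides vanish whatever the sign. *)
have endsB h (psi : R -> R) : psi (Num.max x0 (T h)) - psi (Num.min x0 (T h)) =
    side h * (psi (T h) - psi x0).
  have := sideT h; have [Tx|Tx|->] := ltgtP x0 (T h).
  - rewrite gtr0_norm ?subr_gt0// /side; case: ifP => _; last lra.
    by rewrite !mul1r.
  - rewrite ltr0_norm ?subr_lt0// /side; case: ifP => _; first lra.
    by move=> _; ring.
  - by rewrite !subrr mulr0.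
have F_layers A : measurable A ->
    F A = (\int[leb]_h (side h * (signed_len A (T h) - signed_len A x0))%R%:E)%E.
  move=> mA; rewrite FE//.
  have mind : measurable_fun setT (\1_A : R -> R) by exact: measurable_indic.
  have := layers \1_A mind.
  rewrite (_ : (\int[leb]_x (\1_A x * f x)%:E)%E =
      (\int[leb]_(x in A) (f x)%:E)%E); last first.
    rewrite [RHS]integral_mkcond; apply: eq_integral => x _; rewrite patchE indicE.
    by case: ifP => _; rewrite ?mul1r ?mul0r.
  move=> <- //; apply: eq_integral => h _.
  rewrite integral_indic// -endsB signed_lenB//; last by rewrite ge_min le_max lexx.
  by rewrite /itv_len fineK// lebesgue_itv_fin.
(* The first moment [u h] and the mass [v h] of a slice: their integrals are the mean and the total
   mass of [F], both [1]. *)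
pose u h := side h * (T h - x0) * ((T h + x0) / 2).
pose v h := side h * (T h - x0).
have mv : measurable_fun setT v.
  by apply: measurable_funM; [exact: measurable_side|exact: measurable_funB].
have mu : measurable_fun setT u.
  by apply: measurable_funM => //; apply: measurable_funM => //; exact: measurable_funD.
have v1 : (\int[leb]_h (v h)%:E = 1)%E.
  rewrite -(@probability_setT _ _ _ F) FE//.
  have := layers (cst 1) (measurable_cst _) (fun=> ler01).
  under [RHS]eq_integral do rewrite mul1r.
  move=> <-; apply: eq_integral => h _.
  apply/esym; rewrite (eq_integral (cst 1%E))// integral_cst//= mul1e.
  rewrite lebesgue_measure_itv/= lte_fin.
  case: ifPn => [_|]; first by rewrite -EFinB (endsB h id).
  rewrite -leNgt => le; rewrite /v -(endsB h id)/=.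
  by apply/eqP; rewrite eq_sym eqe subr_eq0 eq_le le ge_min le_max !lexx.
have u1 : (\int[leb]_h (u h)%:E = 1)%E.
  (* The layer formula takes nonnegative functions, so the identity is replaced by its positive
     part, equal to it on [[0, 2]] and hence almost surely. *)
  have mmax : measurable_fun setT (fun x : R => Num.max x 0) by exact: measurable_maxr.
  have max0 (x : R) : 0 <= Num.max x 0 by rewrite le_max lexx orbT.
  have <- : (\int[F]_x (Num.max x 0)%:E = 1)%E.
    rewrite -mean1 unlock; apply: ae_eq_integral => //.
      exact/measurable_EFinP.
    exists (~` `[0, 2]); split; first exact: measurableC.
    - have : F (~` `[0, 2]) = 0%E by rewrite probability_setC// F02 subee.
      exact.
    move=> x /= /not_implyP[_ neq]; rewrite in_itv/= => /andP[xge0 _].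
    by apply: neq; rewrite max_l.
  rewrite (integral_density Ff)// -layers//; apply: eq_integral => h _.
  transitivity (\int[leb]_(x in `[Num.min x0 (T h), Num.max x0 (T h)]) x%:E)%E.
    rewrite integral_id; last by rewrite ge_min le_max lexx.
    have := endsB h (fun x => x ^+ 2 / 2); rewrite -mulrBl => ->.
    by congr EFin; rewrite /u; ring.
  apply: eq_integral => x; rewrite inE/= in_itv/= => /andP[mx _].
  rewrite max_l//; apply: le_trans mx.
  by have := T02 h; move/andP: x02 => [x0ge _] /andP[Tge _]; rewrite le_min x0ge.
have v0 h : 0 <= v h by rewrite /v sideT.
have Tx h : 0 <= T h + x0.
  by have := T02 h; move/andP: x02 => [? _] /andP[? _]; exact: addr_ge0.
have [||||bal fin] := @balanced_moments (fun h => T h + x0 < 2) u v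
    (fun h => side h * (T h - x0) * (T h + x0 - 2)) _ mu mv _ v0 _ _ u1 v1.
- by apply: measurable_fun_ltr => //; exact: measurable_funD.
- by move=> h; apply: mulr_ge0; [exact: v0|exact: divr_ge0].
- move=> h; rewrite -[u h]/(v h * _) -subr_ge0 -[X in if _ then _ else X]subr_ge0.
  have -> : v h - v h * ((T h + x0) / 2) = v h * ((2 - (T h + x0)) / 2) by field.
  have -> : v h * ((T h + x0) / 2) - v h = v h * (((T h + x0) - 2) / 2) by field.
  by case: ifPn => lt2; apply: mulr_ge0 => //; move: lt2; rewrite -?leNgt; lra.
- by move=> h; rewrite /u /v; field.
exact: (D2U_of_layers x02 mT T02 sideT F_layers bal fin).
Qed.

End unimodal_sum.

Unset Implicit Arguments.

Theorem theorem3p2 (R : realType) (F : probability (measurableTypeR R) R)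
    (hdens : exists2 f : R -> R, is_density F f & unimodal f)
    (hsupp : F `[0, 2]%classic = 1%E)
    (hmean : ('E_F[fun x : R => x] = 1)%E) :
  D2U F.
Proof. by have [f Ff uf] := hdens; exact: D2U_of_unimodal Ff uf hsupp hmean. Qed.
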